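(* Let $\Omega\subset(0,\pi/2)$ be a set of upper Minkowski dimension $d<1$. Then, for each $\varepsilon>0$, there exist $\alpha\in\mathbb R$ and a constant $c>0$ such that for all $\gamma\in\Omega$, all $p\in\mathbb Z$ and all integers $q\ge1$ we have $$\left|\tan(\alpha-\gamma)-\frac pq\right|>c\,q^{-\frac{2}{(1-d)^2}-\varepsilon}.$$
   Context: The upper Minkowski dimension of a bounded set $\Omega\subset\mathbb R$ is the infimum of the exponents $s$ such that for all sufficiently small $\delta>0$ the set $\Omega$ can be covered by $O(\delta^{-s})$ intervals of length $\delta$. *)

(* Defs.v *)
From HB Require Import structures.
From mathcomp Require Import all_boot all_order all_algebra.
From mathcomp Require Import all_classical all_reals all_analysis.

Set Implicit Arguments.
Unset Strict Implicit.
Unset Printing Implicit Defensive.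
Import Order.TTheory GRing.Theory Num.Theory.
Import numFieldNormedType.Exports.

Local Open Scope classical_set_scope.
Local Open Scope ring_scope.

Definition covered_by_intervals (R : realType) (Omega : set R) (delta : R)
    (n : nat) : Prop :=
  exists x : nat -> R,
    Omega `<=` \bigcup_(i in `I_n) `[x i, x i + delta]%classic.

Definition covering_exponent (R : realType) (Omega : set R) (s : R) : Prop :=
  exists C : R, \forall delta \near 0^'+,
    exists2 n : nat, n%:R <= C * delta `^ (- s) &
      covered_by_intervals Omega delta n.

(* A covering exponent of a nonempty set is automatically nonnegative, so the
   restriction [0 <= s] only serves to give the empty set dimension 0 rather
   than -oo. *)
Definition upper_minkowski_dim (R : realType) (Omega : set R) : \bar R :=
  ereal_inf [set s%:E | s in [set s : R | 0 <= s /\ covering_exponent Omega s]].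

(* Main.v *)
(** Measure argument. Let [tau] be the exponent, [s > d] a covering exponent with
    [tau (1 - s) > 2]. As [atan] is 1-Lipschitz, [alpha] fails for [gamma] and
    [p/q] only if it lies within [c q^-tau] of [gamma + atan (p/q)]. Covering
    Omega at the scale [dl k = c 2^(-k tau)] for [2^k <= q < 2^(k+1)], the
    failing [alpha] of the k-th dyadic block, which has O(4^k) fractions, have
    measure O(4^k (dl k)^(1-s)) = O(c^(1-s) r^k) with [r = 2^(2 - tau (1-s)) < 1].
    For small [c] the sum is less than the length of [pi/8, 3pi/8], an interval
    keeping [alpha - gamma] away from the poles of [tan]. *)

Require Import Defs.
From HB Require Import structures.
From mathcomp Require Import all_boot all_order all_algebra.
From mathcomp Require Import all_classical all_reals all_analysis.
From mathcomp Require Import ring lra zify.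

Set Implicit Arguments.
Unset Strict Implicit.
Unset Printing Implicit Defensive.
Import Order.TTheory GRing.Theory Num.Theory.
Import numFieldNormedType.Exports.

Local Open Scope classical_set_scope.
Local Open Scope ring_scope.

Lemma measure_bigcup_ord_le d (T : measurableType d) (R : realType)
    (mu : {measure set T -> \bar R}) (F : nat -> set T) (n : nat) (M : R) :
  (forall i, (i < n)%N -> measurable (F i)) ->
  (forall i, (i < n)%N -> (mu (F i) <= M%:E)%E) ->
  (mu (\bigcup_(i in `I_n) F i) <= (n%:R * M)%:E)%E.
Proof.
move=> mF muF; apply: (@le_trans _ _ (\sum_(i < n) mu (F i))%E).
  apply: (content_subadditive mu) => //; last by rewrite bigcup_mkord.
  by apply: fin_bigcup_measurable => // i /mF.
apply: (@le_trans _ _ (\sum_(i < n) M%:E)%E).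
  by apply: lee_sum => i _; apply: muF.
by rewrite sumEFin lee_fin sumr_const card_ord mulr_natl.
Qed.

(** Otherwise the [F k] would cover [[a, b]], and countable subadditivity would bound its length by
    the geometric sum [A / (1 - r)]. *)
Lemma exists_itv_notin_bigcup (R : realType) (a b A r : R)
    (F : nat -> set (measurableTypeR R)) :
  0 <= A -> 0 <= r < 1 -> A / (1 - r) < b - a ->
  (forall k, measurable (F k)) ->
  (forall k, (lebesgue_measure (F k) <= (A * r ^+ k)%:E)%E) ->
  exists2 x : R, x \in `[a, b] & forall k, ~ F k x.
Proof.
move=> A0 /andP[r0 r1] small mF muF.
have ab : a < b.
  rewrite -subr_gt0; apply: le_lt_trans small.
  by rewrite divr_ge0// subr_ge0 ltW.
apply: contrapT => no_pt.
have cov : `[a, b]%classic `<=` \bigcup_k F k.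
  move=> x abx; apply: contrapT => nFx; apply: no_pt.
  by exists x => // k Fkx; apply: nFx; exists k.
have : (lebesgue_measure (`[a, b]%classic : set R) <=
        \sum_(0 <= k <oo) lebesgue_measure (F k))%E.
  exact: (measure_sigma_subadditive lebesgue_measure mF (measurable_itv `[a, b])).
rewrite lebesgue_measure_itv/= lte_fin ab -EFinB leNgt => /negP; apply.
apply: le_lt_trans (_ : _ <= (A / (1 - r))%:E)%E _; last by rewrite lte_fin.
have sumE n : (\sum_(0 <= k < n) (A * r ^+ k)%:E <= (A / (1 - r))%:E)%E.
  have r1' : r != 1 by rewrite lt_eqF.
  have /(congr1 (fun u => u n)) := geometric_seriesE A r1'.
  rewrite sumEFin lee_fin /series/= => ->.
  rewrite ler_pM2r ?invr_gt0 ?subr_gt0//.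
  by rewrite -[leRHS]mulr1 ler_wpM2l// gerBl exprn_ge0.
apply: le_trans (lee_nneseries _ (fun k _ => muF k)) _ => //.
apply: lime_le; last by apply: nearW => n; exact: sumE.
by apply: is_cvg_nneseries => n _ _; rewrite lee_fin mulr_ge0// exprn_ge0.
Qed.

Lemma atan_lipschitz (R : realType) (x y : R) : `|atan x - atan y| <= `|x - y|.
Proof.
wlog yx : x y / y <= x.
  by move=> H; have [/H//|/ltW/H] := leP y x; rewrite distrC [leRHS]distrC.
have datan z : z \in `]y, x[ -> is_derive z 1 atan (1 + z ^+ 2)^-1.
  by move=> _; exact: is_derive1_atan.
have catan : {within `[y, x], continuous (@atan R)}.
  by apply: derivable_within_continuous => z _; exact: ex_derive.
have [c _ ->] := MVT_segment yx datan catan.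
rewrite normrM ler_piMl// ger0_norm ?invr_ge0 ?addr_ge0 ?sqr_ge0//.
by rewrite invf_le1 ?ltr_pwDl ?sqr_ge0// lerDl sqr_ge0.
Qed.

Lemma ltr_norm_tan (R : realType) (t u : R) :
  0 < u < pi / 2 -> `|t| < u -> `|tan t| < tan u.
Proof.
move=> /andP[u0 u2]; rewrite !ltr_norml -tanN => /andP[ut tu].
by rewrite !ltr_tan ?ut ?tu// in_itv/=; apply/andP; split; lra.
Qed.

Lemma ler_powRN (R : realType) (x y t : R) :
  0 < x -> x <= y -> 0 <= t -> y `^ (- t) <= x `^ (- t).
Proof.
move=> x0 xy t0; have y0 := lt_le_trans x0 xy.
rewrite !powRN lef_pV2 ?posrE ?powR_gt0//.
by rewrite ge0_ler_powR ?nnegrE// ltW.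
Qed.

(** Lets finite unions over natural indices below [2 * M] run through the signed numerators [p]. *)
Lemma absz_shift (p : int) (M : nat) : `|p| < M%:Z ->
  (`|(p + M%:Z)%R|%N < 2 * M)%N /\ `|(p + M%:Z)%R|%N%:Z - M%:Z = p.
Proof. by lia. Qed.

(** The measure argument for arbitrary centres [f p q]; the bound [N] on [|p| / q] leaves only O(q)
    numerators for each denominator. *)
Lemma exists_shift_avoiding (R : realType) (Omega : set R) (s tau a b : R)
    (N : nat) (f : int -> int -> R) :
  s < 1 -> 2 < tau * (1 - s) -> covering_exponent Omega s -> a < b ->
  exists c : R, 0 < c < 1 /\ exists2 alpha : R, alpha \in `[a, b] &
    forall (gamma : R) (p q : int), Omega gamma -> 1 <= q -> `|p| < N%:Z * q ->
      c * q%:~R `^ (- tau) < `|alpha - gamma - f p q|.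
Proof.
move=> s1 tau2 [C [e0 /= e0_gt0 cov]] ab.
(* 24 = 2 * 4 * 3: [2 * 2^k] denominators, [4 * N * 2^k] numerators, intervals of length
   [3 * dl k]. *)
pose K : R := 24 * N%:R * `|C|.
pose r : R := 2 `^ (2 - tau * (1 - s)).
have K0 : 0 <= K by rewrite !mulr_ge0.
have r01 : 0 <= r < 1.
  rewrite powR_ge0/= /r /powR pnatr_eq0/= -[ltRHS]expR0 ltr_expR.
  by rewrite nmulr_rlt0 ?ln_gt0 ?ltr1n//; lra.
(* [c < e0] makes every scale [dl k] admissible for the covering; the last bound holds for small [c]
   because [c^(1 - s)] tends to 0. *)
have [c [c01 ce0 csmall]] : exists c : R,
    [/\ 0 < c < 1, c < e0 & K * c `^ (1 - s) / (1 - r) < b - a].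
  have s1' : 0 < 1 - s by rewrite subr_gt0.
  have ba : 0 < b - a by rewrite subr_gt0.
  have lim0 : K * c `^ (1 - s) / (1 - r) @[c --> (0 : R)^'+] --> (0 : R).
    rewrite [X in _ --> X](_ : _ = K * 0 / (1 - r)); last first.
      by rewrite mulr0 mul0r.
    apply: cvgM; last exact: cvg_cst.
    by apply: cvgM; [exact: cvg_cst|exact: powR_cvg0].
  near (0 : R)^'+ => c; exists c; split.
  - by apply/andP; split; near: c; [exact: nbhs_right_gt|exact: nbhs_right_lt].
  - by near: c; exact: nbhs_right_lt.
  - by near: c; exact: (cvgr_lt _ lim0).
have /andP[c0 c1] := c01.
have tau0 : 0 < tau.
  by rewrite -(pmulr_lgt0 _ (_ : 0 < 1 - s)) ?subr_gt0//; apply: lt_trans tau2.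
pose dl k : R := c * 2 `^ (- tau * k%:R).
have dl0 k : 0 < dl k by rewrite mulr_gt0// powR_gt0.
have dle0 k : dl k < e0.
  apply: le_lt_trans ce0; rewrite ler_piMr ?(ltW c0)//.
  rewrite -[leRHS](powRr0 2) ler_powR ?ler1n// mulNr oppr_le0 mulr_ge0//.
  exact: ltW.
have /choice[nx nxP] k : exists nx : nat * (nat -> R),
    nx.1%:R <= `|C| * dl k `^ (- s) /\
    Omega `<=` \bigcup_(i in `I_nx.1) `[nx.2 i, nx.2 i + dl k]%classic.
  have [] := cov (dl k).
  - by rewrite /ball_ /= sub0r normrN gtr0_norm.
  - exact: dl0.
  - move=> n nC [x Ox]; exists (n, x); split => //=.
    by apply: le_trans nC _; rewrite ler_wpM2r ?powR_ge0 ?ler_norm.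
(* The i-th covering interval, translated by [f p q] and widened by [dl k] on both sides: it
   contains every [alpha] failing for some [gamma] of that interval. *)
pose I k (p q : int) i : set (measurableTypeR R) :=
  `[(nx k).2 i + f p q - dl k, (nx k).2 i + f p q + 2 * dl k]%classic.
(* All denominators below [2^(k+1)] are taken, not only those of the block; the count stays
   O(4^k). *)
pose F k : set (measurableTypeR R) :=
  \bigcup_(q in `I_(2 ^ k.+1)) \bigcup_(j in `I_(2 * (N * 2 ^ k.+1)))
  \bigcup_(i in `I_(nx k).1) I k (j%:Z - (N * 2 ^ k.+1)%:Z) q%:Z i.
have mI k p q i : measurable (I k p q i) by exact: measurable_itv.
have mF k : measurable (F k).
  by do 3 (apply: bigcup_measurable => ? _); exact: mI.
have muF k : (lebesgue_measure (F k) <= (K * c `^ (1 - s) * r ^+ k)%:E)%E.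
  have muI p q i : (lebesgue_measure (I k p q i) <= (3 * dl k)%:E)%E.
    rewrite lebesgue_measure_itv/= lte_fin; case: ifP => _.
      by rewrite -EFinB lee_fin; lra.
    by rewrite lee_fin mulr_ge0// ltW.
  apply: (@le_trans _ _ ((2 ^ k.+1)%:R * ((2 * (N * 2 ^ k.+1))%:R *
                           ((nx k).1%:R * (3 * dl k))))%:E).
    apply: measure_bigcup_ord_le => [q _|q _].
      by do 2 (apply: bigcup_measurable => ? _); exact: mI.
    apply: measure_bigcup_ord_le => [j _|j _].
      by apply: bigcup_measurable => ? _; exact: mI.
    by apply: measure_bigcup_ord_le => i _; [exact: mI|exact: muI].
  have rE : r ^+ k = 2 ^+ k * 2 ^+ k * (2 `^ (- tau * k%:R)) `^ (1 - s).
    rewrite -!powR_mulrn ?powR_ge0// -!powRrM -!powRD ?pnatr_eq0 ?implybT//.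
    by congr (_ `^ _); ring.
  (* Number of covering intervals times their length, up to constants, with the factors in [c] and
     in [k] separated. *)
  have dlE : dl k `^ (- s) * dl k
           = c `^ (1 - s) * (2 `^ (- tau * k%:R)) `^ (1 - s).
    rewrite -{2}[dl k]powRr1 ?(ltW (dl0 k))//.
    rewrite -powRD ?(gt_eqF (dl0 k)) ?implybT// addrC powRM ?powR_ge0//.
    exact: ltW.
  have [nC _] := nxP k.
  rewrite lee_fin.
  apply: (@le_trans _ _ ((2 ^ k.+1)%:R * ((2 * (N * 2 ^ k.+1))%:R *
                           (`|C| * dl k `^ (- s) * (3 * dl k))))).
    by rewrite !ler_wpM2l// ler_wpM2r// mulr_ge0// ltW.
  rewrite rE !natrM !natrX !exprS /K.
  rewrite [leRHS](_ : _ = 24 * N%:R * `|C| * 2 ^+ k * 2 ^+ k *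
    (c `^ (1 - s) * (2 `^ (- tau * k%:R)) `^ (1 - s))); last by ring.
  by rewrite -dlE le_eqVlt; apply/orP; left; apply/eqP; ring.
have A0 : 0 <= K * c `^ (1 - s) by rewrite mulr_ge0 ?powR_ge0.
have [alpha alphaab alphaF] := exists_itv_notin_bigcup A0 r01 csmall mF muF.
exists c; split=> //; exists alpha => // gamma p q Ogamma q1 pNq.
rewrite ltNge; apply/negP => close.
case: q => [q|//] in q1 pNq close *.
have q0 : (0 < q)%N by rewrite -ltz_nat.
pose k := trunc_log 2 q.
have /andP[kq qk] : (2 ^ k <= q < 2 ^ k.+1)%N by exact: trunc_log_bounds.
(* Since [2^k <= q] and [tau > 0], [q^(-tau)] is at most [2^(-k tau)]. *)
have {}close : `|alpha - gamma - f p q| <= dl k.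
  apply: le_trans close _; rewrite ler_pM2l// [_ * k%:R]mulrC powRrM powR_mulrn//.
  by apply: ler_powRN; [rewrite exprn_gt0|rewrite -natrX ler_nat|exact: ltW].
have [_ /(_ _ Ogamma)[i /= ik]] := nxP k.
rewrite in_itv/= => /andP[xi1 xi2].
apply: (alphaF k); exists q => //.
have pN : `|p| < (N * 2 ^ k.+1)%:Z.
  by apply: lt_le_trans pNq _; rewrite -PoszM lez_nat leq_mul// ltnW.
have [jN jE] := absz_shift pN.
exists `|(p + (N * 2 ^ k.+1)%:Z)%R|%N => //.
exists i => //; rewrite /I jE.
move: close; rewrite ler_norml => /andP[l1 l2].
by rewrite /= in_itv/=; apply/andP; split; lra.
Unshelve. all: by end_near.
Qed.

Theorem lemma2p21 (R : realType) (Omega : set R) (d : R)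
    (Omega_sub : Omega `<=` `]0, pi / 2[%classic)
    (dim_Omega : upper_minkowski_dim Omega = d%:E) (d_lt1 : d < 1)
    (eps : R) (eps_gt0 : 0 < eps) :
  exists alpha c : R, 0 < c /\
    forall gamma : R, Omega gamma ->
      cos (alpha - gamma) != 0 /\
      forall p q : int, 1 <= q ->
        `|tan (alpha - gamma) - p%:~R / q%:~R|
          > c * q%:~R `^ (- (2 / (1 - d) ^+ 2) - eps).
Proof.
set D := 2 / (1 - d) ^+ 2.
have d0 : 0 <= d.
  rewrite -lee_fin -dim_Omega; apply: le_ereal_inf_tmp => _ [s [s0 _] <-].
  by rewrite lee_fin.
have tau0 : 0 < D + eps by rewrite addr_gt0// divr_gt0// exprn_gt0// subr_gt0.
(* The product is [2 / (1 - d) + eps * (1 - d)]: the first term is at least 2 as [0 <= d < 1], and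
   [eps] gives strictness. *)
have tau_d : 2 < (D + eps) * (1 - d).
  have d1 : 0 < 1 - d by rewrite subr_gt0.
  have -> : (D + eps) * (1 - d) = 2 / (1 - d) + eps * (1 - d).
    by rewrite /D; field; rewrite gt_eqF.
  apply: (@le_lt_trans _ _ (2 / (1 - d))); last by rewrite ltrDl mulr_gt0.
  by rewrite ler_pdivlMr// ler_piMr// gerBl.
(* By [tau_d] the infimum [d] lies below [1 - 2 / (D + eps)], hence so does some covering exponent
   [s]. *)
have [_ [s [_ cov] <-]] :
    exists2 x : \bar R, [set s%:E | s in
      [set s : R | 0 <= s /\ covering_exponent Omega s]] x &
      (x < (1 - 2 / (D + eps))%:E)%E.
  apply: ereal_inf_lt; rewrite [ltLHS]dim_Omega lte_fin ltrBrDr -ltrBrDl.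
  by rewrite ltr_pdivrMr// mulrC.
rewrite lte_fin ltrBrDr -ltrBrDl ltr_pdivrMr// [_ * (D + eps)]mulrC => tau_s.
have s1 : s < 1.
  rewrite -subr_gt0 -(pmulr_rgt0 _ tau0); exact: lt_trans tau_s.
have pi0 := pi_gt0 R.
(* For [alpha] in [[pi/8, 3pi/8]] and [gamma] in [(0, pi/2)], [|alpha - gamma| < u]. *)
pose u : R := 3 * pi / 8.
have u2 : 0 < u < pi / 2 by rewrite /u; apply/andP; split; lra.
(* A fraction within 1 of [tan (alpha - gamma)] has absolute value below [tan u + 1], hence below
   [N]. *)
pose N := Num.bound (tan u + 1).
have ab : pi / 8 < u by rewrite /u; lra.
have [c [/andP[c0 c1] [alpha]]] := exists_shift_avoiding N
  (fun p q => atan (p%:~R / q%:~R)) s1 tau_s cov ab.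
rewrite in_itv/= => /andP[al1 al2] avoid.
exists alpha, c; split=> // gamma Ogamma.
have := Omega_sub _ Ogamma; rewrite /= in_itv/= => /andP[g0 g2].
have tu : `|alpha - gamma| < u.
  by rewrite ltr_norml /u in al2 *; apply/andP; split; lra.
have tpi : - (pi / 2) < alpha - gamma < pi / 2.
  move: tu u2; rewrite ltr_norml => /andP[? ?] /andP[? ?].
  by apply/andP; split; lra.
split; first by rewrite gt_eqF// cos_gt0_pihalf.
move=> p q q1; rewrite ltNge -opprD; apply/negP => close.
have q0 : 0 < q%:~R :> R by rewrite ltr0z (lt_le_trans _ q1).
(* From [c < 1] and [q >= 1]: a violating [p/q] is within 1 of the tangent, which bounds [|p|] by
   [N * q]. *)
have qle1 : c * q%:~R `^ (- (D + eps)) <= 1.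
  apply: mulr_ile1; rewrite ?powR_ge0 ?(ltW c0) ?(ltW c1)//.
  have := @ler_powRN R 1 q%:~R (D + eps) ltr01.
  by rewrite powR1; apply; [rewrite ler1z|exact: ltW].
have pNq : `|p| < N%:Z * q.
  have tan_lt := ltr_norm_tan u2 tu.
  rewrite -(ltr_int R) intr_norm intrM -ltr_pdivrMr//.
  rewrite -[q%:~R in ltLHS]gtr0_norm// -normf_div.
  apply: le_lt_trans (_ : _ <= tan u + 1) _; last first.
    by rewrite archi_boundP// addr_ge0// (le_trans _ (ltW tan_lt)).
  move: tan_lt; have := le_trans close qle1.
  rewrite ler_distl => /andP[? ?]; rewrite ltr_norml => /andP[? ?].
  by rewrite ler_norml; apply/andP; split; lra.
have := avoid _ _ _ Ogamma q1 pNq; rewrite ltNge => /negP; apply.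
apply: le_trans close.
(* On this interval [atan] inverts [tan], so its Lipschitz bound carries closeness of tangents over
   to angles, against [avoid]. *)
have tpi' : alpha - gamma \in `]- (pi / 2), (pi / 2)[ by rewrite in_itv.
by rewrite -[X in `|X - _|](tanK tpi'); exact: atan_lipschitz.
Qed.
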